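(* Let $\mathsf{k}$ be a field of characteristic zero, $S=\mathsf{k}[x,y,z]$, $R=\mathsf{k}[X,Y,Z]$ with $S$ acting by differentiation. Let $F\in R$ be nonzero homogeneous of even degree $d\ge2$, $A=S/\operatorname{Ann}_S(F)$, and $\ell\in S_1$ with $\ell^2\ne0$ and $\ell^3=0$ in $A$. Set $(r,s,t)=(h_{A^{(2)}}(\frac d2-1),h_{A^{(1)}}(\frac d2-1),h_A(\frac d2))$. Then the Hilbert functions of $A$, $A^{(1)}$, $A^{(2)}$ are determined by $(r,s,t)$ as follows. (1) If $d\ge4$, $r\in[1,\frac d2-1]$, $s\in[2r,\frac d2+r]$ and $t\in[2s-r,\frac d2+s+1]$, then $h_{A^{(2)}}(i)=i+1$ for $0\le i\le r-1$ and $h_{A^{(2)}}(i)=r$ for $r\le i\le \frac d2-1$; $h_{A^{(1)}}(i)=2i+1$ for $0\le i\le r-1$, $h_{A^{(1)}}(i)=i+r+1$ for $r\le i\le s-r-1$, and $h_{A^{(1)}}(i)=s$ for $s-r\le i\le\frac d2-1$. If $t=3r$, then $h_A$ is one of the following two functions on $0\le i\le \frac d2$: (a) $h_A(0)=1$, $h_A(i)=3i$ for $1\le i\le r-1$, $h_A(i)=3r$ for $r\le i\le\frac d2$; or (b) $h_A(0)=1$, $h_A(i)=3i$ for $1\le i\le r-1$, $h_A(r)=3r-1$, $h_A(i)=3r$ for $r+1\le i\le \frac d2$. Otherwise (i.e. $t>3r$): $h_A(0)=1$; $h_A(i)=3i$ for $1\le i\le r$; $h_A(i)=2i+r+1$ for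 $r+1\le i\le s-r-1$; at $i=s-r$, $h_A(i)=2i+r+1$ if $t>2s-r$ and $s>2r$, and $h_A(i)=2i+r$ if $t>2s-r$ and $s=2r$; $h_A(i)=i+s+1$ for $s-r+1\le i\le t-s-1$; and $h_A(i)=t$ for $t-s\le i\le\frac d2$. (2) If $d\ge2$, $r=\frac d2$, $s=d-1$ and $t\in[\frac{3d}{2}-2,\frac{3d}{2}]$, then for every $0\le i\le\frac d2-1$, $h_{A^{(2)}}(i)=i+1$ and $h_{A^{(1)}}(i)=2i+1$, and $h_A(0)=1$, $h_A(i)=3i$ for $1\le i\le\frac d2-1$, $h_A(\frac d2)=t$.
   Context: $x,y,z$ act as $\partial/\partial X,\partial/\partial Y,\partial/\partial Z$; $\operatorname{Ann}_S(G)=\{g\in S:g\circ G=0\}$. $\ell^k=0$ in $A$ means $\ell^k\circ F=0$. $A^{(i)}:=S/\operatorname{Ann}_S(\ell^i\circ F)$ (an Artinian Gorenstein algebra of socle degree $d-i$ when $\ell^i\circ F\neq 0$); $h_B(j)=\dim_{\mathsf{k}}B_j$. Intervals $[a,b]$ denote sets of integers. *)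

(* Defs.v *)
From HB Require Import structures.
From mathcomp Require Import all_boot all_order all_algebra.
From mathcomp Require Import mpoly.
Set Implicit Arguments. Unset Strict Implicit. Unset Printing Implicit Defensive.
Import GRing.Theory.
Local Open Scope ring_scope.

(* S = k[x,y,z] and R = k[X,Y,Z] are both modelled by {mpoly k[3]};
   the variable x_i of S acts as the partial derivative d/dX_i on R. *)

Definition apolar (k : fieldType) (g G : {mpoly k[3]}) : {mpoly k[3]} :=
  \sum_(m <- msupp g) g@_m *: G^`M[m].

Definition hdeg (j : nat) := {m : 'X_{1..3 < j.+1} | mdeg m == j}.

(* Matrix of the map S_j -> R,  g |-> g o G,  in the monomial bases
   (rows: monomials of degree j of S; columns: monomials of R of degree
   < msize G, which contain every monomial of every g o G). *)
Definition contr_mx (k : fieldType) (G : {mpoly k[3]}) (j : nat)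
  : 'M[k]_(#|{: hdeg j}|, #|{: 'X_{1..3 < msize G}}|) :=
  \matrix_(a, b) (apolar 'X_[val (val (@enum_val (hdeg j) predT a))] G)
                    @_(val (@enum_val 'X_{1..3 < msize G} predT b)).

(* h_B(j) = dim_k B_j for B = S / Ann_S(G):  B_j = S_j / Ann_S(G)_j, and
   the row space of kermx (contr_mx G j) is exactly (the coordinate space of)
   Ann_S(G)_j = { g in S_j | g o G = 0 }. *)
Definition hilbA (k : fieldType) (G : {mpoly k[3]}) (j : nat) : nat :=
  (#|{: hdeg j}| - \rank (kermx (contr_mx G j)))%N.

(* Main.v *)
Require Import Defs.
From HB Require Import structures.
From mathcomp Require Import all_boot all_order all_algebra.
From mathcomp Require Import ssrcomplements mpoly.
From mathcomp Require Import zify.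
Set Implicit Arguments. Unset Strict Implicit. Unset Printing Implicit Defensive.
Import GRing.Theory.

(** Multiplication by [l] embeds [A^(i+1)] into [A^(i)] with a shift by one, and
    the cokernel is a quotient of the two-variable polynomial ring [S / (l)].  The
    Hilbert function of the cokernel is therefore [j + 1] up to some degree, and
    nonincreasing afterwards, because a nonzero space [W] of univariate
    polynomials satisfies [dim (W + X W) > dim W].  In characteristic zero the
    Hilbert functions of [A], [A^(1)] and [A^(2)] are also symmetric, by
    transposition of catalecticant matrices.  Since [l^3] kills [F], the growth
    of the cokernels and the symmetry determine [A^(2)], then [A^(1)], then [A]
    from their middle values; in case (2) one needs in addition that [A^(2)] is a
    quotient of [A / (l)]. *)

(** * The action of [S] on [R] by differentiation *)

Section Apolar.
Local Open Scope ring_scope.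
Variable k : fieldType.
Implicit Types (g p q G : {mpoly k[3]}) (m : 'X_{1..3}).

(** The index set no longer depends on the support of [g], so sums for different [g] can be compared
    term by term. *)
Lemma apolar_bounded n g G : (msize g <= n)%N ->
  apolar g G = \sum_(m : 'X_{1..3 < n}) g@_m *: G^`M[m].
Proof.
move=> le_gn; set I : subFinType _ := 'X_{1..3 < n}.
rewrite /apolar (big_mksub I) ?msupp_uniq //=; last first.
  by move=> x /msize_mdeg_lt /leq_trans; apply.
by rewrite big_rmcond //= => m /memN_msupp_eq0 ->; rewrite scale0r.
Qed.

Lemma apolar_linear G : linear (fun g => apolar g G).
Proof.
move=> c p q; pose n := maxn (msize (c *: p + q)) (maxn (msize p) (msize q)).
rewrite !(@apolar_bounded n) ?leq_max ?leqnn ?orbT //.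
rewrite scaler_sumr -big_split /=; apply: eq_bigr => m _.
by rewrite mcoeffD mcoeffZ scalerDl scalerA.
Qed.

Lemma apolarXE m G : apolar 'X_[m] G = G^`M[m].
Proof. by rewrite /apolar msuppX big_seq1 mcoeffX eqxx scale1r. Qed.

Lemma apolar_sum (I : Type) (r : seq I) (c : I -> k) (f : I -> {mpoly k[3]}) G :
  apolar (\sum_(i <- r) c i *: f i) G = \sum_(i <- r) c i *: apolar (f i) G.
Proof.
elim: r => [|i r IHr]; first by rewrite !big_nil /apolar msupp0 big_nil.
by rewrite !big_cons apolar_linear IHr.
Qed.

Lemma apolarM p q G : apolar (p * q) G = apolar p (apolar q G).
Proof.
rewrite [in LHS](mpolyE p) mulr_suml.
under eq_bigr do rewrite -scalerAl.
rewrite apolar_sum [RHS]/apolar; apply: eq_bigr => m _; congr (_ *: _).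
rewrite [in LHS](mpolyE q) mulr_sumr.
under eq_bigr do rewrite -scalerAr -mpolyXD.
rewrite apolar_sum [apolar q G]/apolar raddf_sum; apply: eq_bigr => m' _ /=.
by rewrite mderivmZ apolarXE addmC mderivmDm.
Qed.

Lemma apolar0 p : apolar p 0 = 0.
Proof. by rewrite /apolar big1 // => m _; rewrite raddf0 scaler0. Qed.

(** Differentiation never raises the degree. Hence the finitely many columns of [contr_mx] detect
    whether [apolar g G] vanishes. *)
Lemma mcoeff_apolar_supp g G m : (apolar g G)@_m != 0 -> (mdeg m < msize G)%N.
Proof.
apply: contraNltn => le_Gm; rewrite /apolar raddf_sum big1 //= => m' _.
rewrite mcoeffZ mcoeff_mderivm (@memN_msupp_eq0 _ _ G) ?mul0rn ?mulr0 //.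
by apply/negP => /msize_mdeg_lt; rewrite mdegD ltnNge (leq_trans le_Gm) ?leq_addl.
Qed.

Lemma apolar_homog i d g G : g \is i.-homog -> G \is d.-homog ->
  apolar g G \is (d - i).-homog.
Proof.
move=> /dhomogP hg /dhomogP hG; rewrite /apolar big_seq rpred_sum // => m gm.
apply/rpredZ/dhomogP => m'; rewrite mcoeff_msupp mcoeff_mderivm => nz.
have /hG dE : (m + m')%MM \in msupp G.
  by rewrite mcoeff_msupp; apply: contraNneq nz => ->; rewrite mul0rn.
by move: (hg _ gm) dE => /= <-; rewrite mdegD => <-; rewrite addKn.
Qed.

End Apolar.

Notation nmon j := #|{: hdeg j}|.

(** * Forms as row vectors, and symmetry of the Hilbert function *)

Section Coordinates.
Local Open Scope ring_scope.
Variable k : fieldType.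
Implicit Types (g p q G : {mpoly k[3]}) (m : 'X_{1..3}).

Definition mon j (a : 'I_(nmon j)) : 'X_{1..3} :=
  val (val (@enum_val (hdeg j) predT a)).

Lemma mdeg_mon j (a : 'I_(nmon j)) : mdeg (mon a) = j.
Proof. exact/eqP/(valP (enum_val a)). Qed.

Lemma mon_inj j : injective (@mon j).
Proof. by move=> a b /val_inj /val_inj /enum_val_inj. Qed.

Lemma mon_surj j m : mdeg m = j -> exists a : 'I_(nmon j), mon a = m.
Proof.
move=> mj; have lt_mj : (mdeg m < j.+1)%N by rewrite mj.
have mj' : mdeg (BMultinom lt_mj) == j by rewrite /= mj.
exists (enum_rank (Sub (BMultinom lt_mj) mj' : hdeg j)).
by rewrite /mon enum_rankK.
Qed.

Lemma nmonE j : nmon j = 'C(j.+2, 2).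
Proof.
have -> : 'C(j.+2, 2) = 'C(j + 2, j) by rewrite -bin_sub ?addn2 ?subSS ?subn0 //; lia.
rewrite -(@size_basis 2 j) -[LHS](size_enum_ord) -(size_map (@mon j)).
apply/perm_size/uniq_perm.
- by rewrite (map_inj_uniq (@mon_inj j)) enum_uniq.
- exact: uniq_basis.
move=> m; rewrite -basis_cover; apply/mapP/eqP => [[a _ ->]|].
  exact: mdeg_mon.
by case/mon_surj=> a <-; exists a; rewrite ?mem_enum.
Qed.

Lemma nmonS j : nmon j.+1 = (nmon j + j.+2)%N.
Proof. by rewrite !nmonE binS bin1 addnC. Qed.

Definition rVform j (v : 'rV[k]_(nmon j)) : {mpoly k[3]} :=
  \sum_a v 0 a *: 'X_[mon a].

Definition form_rV j (p : {mpoly k[3]}) : 'rV[k]_(nmon j) := \row_a p@_(mon a).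

Lemma rVform_linear j : linear (@rVform j).
Proof.
move=> c u v; rewrite /rVform scaler_sumr -big_split /=.
by apply: eq_bigr => a _; rewrite !mxE scalerDl scalerA.
Qed.

HB.instance Definition _ j :=
  GRing.isLinear.Build k 'rV[k]_(nmon j) {mpoly k[3]} _ (@rVform j) (@rVform_linear j).

Lemma form_rV_linear j : linear (@form_rV j).
Proof. by move=> c u v; apply/rowP => a; rewrite !mxE mcoeffD mcoeffZ. Qed.

HB.instance Definition _ j :=
  GRing.isLinear.Build k {mpoly k[3]} 'rV[k]_(nmon j) _ (@form_rV j) (@form_rV_linear j).

Lemma rVform_homog j (v : 'rV[k]_(nmon j)) : rVform v \is j.-homog.
Proof.
by rewrite rpred_sum // => a _; rewrite rpredZ // dhomogX; apply/eqP/mdeg_mon.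
Qed.

Lemma rVformK j : cancel (@rVform j) (@form_rV j).
Proof.
move=> v; apply/rowP => a; rewrite mxE raddf_sum /= (bigD1 a) //=.
rewrite mcoeffZ mcoeffX eqxx mulr1 big1 ?addr0 // => b nab.
by rewrite mcoeffZ mcoeffX (inj_eq (@mon_inj j)) (negbTE nab) mulr0.
Qed.

Lemma form_rV_eq0 j p : p \is j.-homog -> (form_rV j p == 0) = (p == 0).
Proof.
move=> hp; apply/eqP/eqP => [p0|->]; last by rewrite raddf0.
apply/mpolyP => m; rewrite mcoeff0.
have [/mon_surj [a <-]|/eqP nm] := eqVneq (mdeg m) j.
  by move/rowP/(_ a): p0; rewrite !mxE.
exact: dhomog_nemf_coeff hp (introN eqP nm).
Qed.

Lemma form_rV_K j p : p \is j.-homog -> rVform (form_rV j p) = p.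
Proof.
move=> hp; apply/eqP; rewrite -subr_eq0 -(@form_rV_eq0 j) ?raddfB /= ?rVformK ?subrr //.
by rewrite rpredB ?rVform_homog.
Qed.

Lemma apolar_rVform j (v : 'rV[k]_(nmon j)) G :
  apolar (rVform v) G = \sum_a v 0 a *: apolar 'X_[mon a] G.
Proof. exact: apolar_sum. Qed.

Lemma mulmx_contr_mxE G j (v : 'rV[k]_(nmon j)) b :
  (v *m contr_mx G j) 0 b = (apolar (rVform v) G)@_(val (enum_val b)).
Proof.
rewrite mxE apolar_rVform raddf_sum /=.
by apply: eq_bigr => a _; rewrite mcoeffZ mxE.
Qed.

Lemma sub_ker_contr_mx G j (v : 'rV[k]_(nmon j)) :
  (v <= kermx (contr_mx G j))%MS = (apolar (rVform v) G == 0).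
Proof.
apply/sub_kermxP/eqP => [v0|v0]; last first.
  by apply/rowP => b; rewrite mulmx_contr_mxE v0 mcoeff0 mxE.
apply/mpolyP => m; rewrite mcoeff0; apply/eqP/negPn/negP => nz.
have lt_m := mcoeff_apolar_supp nz.
move/rowP/(_ (enum_rank (BMultinom lt_m))): v0.
by rewrite mulmx_contr_mxE enum_rankK mxE /=; move/eqP: nz.
Qed.

Lemma hilbA_rank G j : hilbA G j = \rank (contr_mx G j).
Proof. by rewrite /hilbA mxrank_ker subKn // rank_leq_row. Qed.

Lemma rank_ker_hilbA G j : (\rank (kermx (contr_mx G j)) + hilbA G j)%N = nmon j.
Proof. by rewrite /hilbA subnKC // rank_leq_row. Qed.

Lemma hilbA0 j : hilbA (0 : {mpoly k[3]}) j = 0%N.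
Proof.
rewrite hilbA_rank; apply/eqP; rewrite mxrank_eq0; apply/eqP/matrixP => a b.
by rewrite !mxE apolar0 mcoeff0.
Qed.

(** The catalecticant matrix of [G]: for [G] homogeneous of degree [i + j], these columns are the
    only ones of [contr_mx G i] that can be nonzero. *)
Definition cat_mx G i j : 'M[k]_(nmon i, nmon j) :=
  \matrix_(a, b) (apolar 'X_[mon a] G)@_(mon b).

Lemma hilbA_cat_mx G d i j : G \is d.-homog -> (i + j)%N = d ->
  hilbA G i = \rank (cat_mx G i j).
Proof.
move=> hG ij; rewrite /hilbA.
suff eqK : (kermx (contr_mx G i) :=: kermx (cat_mx G i j))%MS.
  by rewrite eqK mxrank_ker subKn // rank_leq_row.
have catE (v : 'rV_(nmon i)) : v *m cat_mx G i j = form_rV j (apolar (rVform v) G).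
  apply/rowP => b; rewrite !mxE apolar_rVform raddf_sum /=.
  by apply: eq_bigr => a _; rewrite mcoeffZ mxE.
apply/eqmxP; apply/andP; split; apply/rV_subP => v.
  by rewrite sub_ker_contr_mx => /eqP v0; apply/sub_kermxP; rewrite catE v0 raddf0.
move/sub_kermxP/eqP; rewrite catE sub_ker_contr_mx form_rV_eq0 //.
have -> : j = (d - i)%N by rewrite -ij addKn.
exact: apolar_homog (rVform_homog v) hG.
Qed.

Definition mfact m : nat := (\prod_(i < 3) (m i)`!)%N.

(** With [m = mon a + mon b], the entry at [(a, b)] is [G@_m] times [mfact m / mfact (mon b)].
    Clearing the denominator gives [G@_m] times [mfact m], which is symmetric in [a] and [b]. *)
Lemma cat_mx_sym G i j (a : 'I_(nmon i)) (b : 'I_(nmon j)) :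
  cat_mx G i j a b * (mfact (mon b))%:R = cat_mx G j i b a * (mfact (mon a))%:R.
Proof.
rewrite !mxE !apolarXE !mcoeff_mderivm addmC !mulr_natr.
rewrite -!mulrnA; congr (_ *+ _).
rewrite /mfact -!big_split /=; apply: eq_bigr => c _; rewrite !mnmDE.
have := @ffact_fact (mon b c + mon a c) (mon a c) (leq_addl _ _).
have := @ffact_fact (mon b c + mon a c) (mon b c) (leq_addr _ _).
by rewrite addKn addnK => -> ->.
Qed.

Hypothesis chark : [pchar k] =i pred0.

Lemma mfact_neq0 m : (mfact m)%:R != 0 :> k.
Proof.
rewrite (pcharf0P _).1 //; apply: lt0n_neq0; rewrite prodn_gt0 // => i.
exact: fact_gt0.
Qed.

(** In characteristic zero the diagonal matrices of factorials are invertible, so [cat_mx G i j] and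
    the transpose of [cat_mx G j i] differ only by invertible factors. *)
Lemma rank_cat_mx_le G i j : (\rank (cat_mx G i j) <= \rank (cat_mx G j i))%N.
Proof.
pose D n := diag_mx (\row_(b < nmon n) (mfact (mon b))%:R) : 'M[k]_(nmon n).
pose E n := diag_mx (\row_(b < nmon n) (mfact (mon b))%:R^-1) : 'M[k]_(nmon n).
have DE n : D n *m E n = 1%:M.
  rewrite mulmx_diag; apply/matrixP => a b; rewrite !mxE.
  by case: eqP => // ->; rewrite divff ?mfact_neq0.
have symD : cat_mx G i j *m D j = (cat_mx G j i *m D i)^T.
  apply/matrixP => a b; rewrite [RHS]mxE !mul_mx_diag [LHS]mxE [RHS]mxE.
  by rewrite ![(\row__ _) _ _]mxE cat_mx_sym.
rewrite -[cat_mx G i j]mulmx1 -(DE j) mulmxA symD.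
apply: leq_trans (mxrankM_maxl _ _) _.
by rewrite mxrank_tr mxrankM_maxl.
Qed.

Lemma hilbA_sym G d i j : G \is d.-homog -> (i + j)%N = d ->
  hilbA G i = hilbA G j.
Proof.
move=> hG ij; rewrite (hilbA_cat_mx hG ij).
rewrite (@hilbA_cat_mx G d j i) 1?addnC //.
by apply/eqP; rewrite eqn_leq !rank_cat_mx_le.
Qed.

End Coordinates.

(** * Growth of spaces of univariate polynomials under multiplication by ['X] *)

Section Growth.
Local Open Scope ring_scope.
Variable k : fieldType.

(* If the rank did not grow, [W] would be stable under multiplication by ['X],
   so it would contain polynomials of arbitrarily large degree. *)
Lemma rank_mulX_growth n a b (W : 'M[k]_(a, n)) (W' : 'M[k]_(b, n.+1)) :
    W != 0 ->
    (forall v : 'rV_n, (v <= W)%MS -> (poly_rV (rVpoly v) <= W')%MS) ->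
    (forall v : 'rV_n, (v <= W)%MS -> (poly_rV ('X * rVpoly v) <= W')%MS) ->
  (\rank W < \rank W')%N.
Proof.
move=> W0 W1 WX; pose E : 'M[k]_(n, n.+1) := lin1_mx (poly_rV \o rVpoly).
have Einj (v : 'rV_n) : rVpoly (v *m E) = rVpoly v.
  by rewrite mul_rV_lin1 /= poly_rV_K // (leq_trans (size_poly _ _)).
have WE : (W *m E <= W')%MS.
  apply/row_subP => i; rewrite row_mul mul_rV_lin1 /=; exact/W1/row_sub.
have rE : \rank (W *m E) = \rank W.
  apply: mxrankMfree; apply: inj_row_free => v /(congr1 rVpoly).
  by rewrite Einj linear0 => /(congr1 (@poly_rV _ n)); rewrite rVpolyK linear0.
rewrite ltnNge; apply/negP => le_W'W.
have W'E : (W' <= W *m E)%MS by rewrite -(geq_leqif (mxrank_leqif_sup WE)) rE.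
have [v vW v0] : exists2 v : 'rV_n, (v <= W)%MS & v != 0.
  have /rowV0Pn[v vW v0] := W0; by exists v.
have stable m : exists2 u : 'rV_n, (u <= W)%MS & rVpoly u = 'X^m * rVpoly v.
  elim: m => [|m [u uW uE]]; first by exists v; rewrite ?mul1r.
  have /submxP[D DE] := submx_trans (WX _ uW) W'E.
  exists (D *m W); first exact: submxMl.
  rewrite -Einj -mulmxA -DE poly_rV_K; first by rewrite uE mulrA -exprS.
  by rewrite mulrC (leq_trans (size_polyMleq _ _)) // size_polyX addn2 ltnS size_poly.
have [u _ uE] := stable n.
have : (size (rVpoly u) <= n)%N by exact: size_poly.
have p0 : rVpoly v != 0.
  by apply: contraNneq v0 => /(congr1 (@poly_rV _ n)); rewrite rVpolyK linear0 => ->.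
rewrite uE size_monicM ?monicXn // size_polyXn addSn /=.
by rewrite -[leqRHS]addn0 leq_add2l leqNgt size_poly_gt0 p0.
Qed.

End Growth.

(** * Coordinates of a linear form *)

Section LinearForm.
Local Open Scope ring_scope.

Lemma linear_form_sum (k : fieldType) (l : {mpoly k[3]}) : l \is 1.-homog ->
  l = \sum_(i < 3) l@_U_(i) *: 'X_i.
Proof.
move=> hl; apply/mpolyP => m; rewrite raddf_sum /=.
under eq_bigr do rewrite mcoeffZ mcoeffX.
have [/eqP|/eqP m1] := eqVneq (mdeg m) 1%N; last first.
  rewrite (dhomog_nemf_coeff hl (introN eqP m1)) big1 // => i _.
  by case: eqP m1 => [<-|]; rewrite ?mdeg1 ?mulr0.
rewrite mdeg_eq1 => /existsP[i /eqP->].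
rewrite (bigD1 i) //= eqxx mulr1 big1 ?addr0 // => j ji.
by rewrite eq_mnm1 (negbTE ji) mulr0.
Qed.

End LinearForm.

(** * Restriction to the line [l = 0] and the exact sequence of multiplication by [l] *)

Section Restriction.
Local Open Scope ring_scope.
Variables (k : fieldType) (h : 'I_3 -> {poly k}).

(* Restriction to the line [l = 0], in the affine chart where one coordinate
   is [1] and another one is ['X]. *)
Definition restr (p : {mpoly k[3]}) : {poly k} := mmap polyC h p.

HB.instance Definition _ := GRing.RMorphism.copy restr (mmap polyC h).

Lemma restrZ c p : restr (c *: p) = c *: restr p.
Proof. by rewrite /restr mmapZ mul_polyC. Qed.

Lemma restr_sum (I : Type) (r : seq I) (c : I -> k) (f : I -> {mpoly k[3]}) :
  restr (\sum_(i <- r) c i *: f i) = \sum_(i <- r) c i *: restr (f i).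
Proof. by rewrite raddf_sum; apply: eq_bigr => i _; exact: restrZ. Qed.

Lemma restrX i : restr 'X_i = h i.
Proof. by rewrite /restr mmapX mmap1U. Qed.

Hypothesis size_h : forall i, (size (h i) <= 2)%N.

Lemma size_restr j p : p \is j.-homog -> (size (restr p) <= j.+1)%N.
Proof.
move=> /dhomogP hp; rewrite [p]mpolyE restr_sum.
apply: (leq_trans (size_sum _ _ _)); apply/bigmax_leqP_seq => m mp _.
apply: (leq_trans (size_scale_leq _ _)); rewrite /restr mmapX -(hp _ mp) /= mdegE.
rewrite /mmap1; elim/big_rec2: _ => [|i q n _ le_qn]; first by rewrite size_poly1.
apply: (leq_trans (size_polyMleq _ _)).
have le_hm : (size (h i ^+ m i) <= (m i).+1)%N.
  apply: (leq_trans (size_poly_exp_leq _ _)); rewrite ltnS.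
  by rewrite -[leqRHS]mul1n leq_mul2r -subn1 leq_subLR size_h orbT.
by rewrite -subn1 leq_subLR (leq_trans (leq_add le_hm le_qn)) // addSn addnS.
Qed.

Definition restr_mx j : 'M[k]_(nmon j, j.+1) :=
  \matrix_a poly_rV (restr 'X_[mon a]).

Lemma mulmx_restr j (v : 'rV[k]_(nmon j)) :
  v *m restr_mx j = poly_rV (restr (rVform v)).
Proof.
rewrite mulmx_sum_row /rVform restr_sum linear_sum; apply: eq_bigr => a _.
by rewrite rowK linearZ.
Qed.

Variables i1 i2 : 'I_3.
Hypotheses (h1 : h i1 = 1) (h2 : h i2 = 'X).

Lemma restr_mx_full j : row_full (restr_mx j).
Proof.
rewrite -sub1mx; apply/row_subP => c.
(* This monomial restricts to ['X^c], because [h i1 = 1] and [h i2 = 'X]. *)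
pose p : {mpoly k[3]} := 'X_i1 ^+ (j - c) * 'X_i2 ^+ c.
have hp : p \is j.-homog.
  have -> : j = (1 * (j - c) + 1 * c)%N by rewrite !mul1n subnK // -ltnS.
  by apply: dhomogM; apply: dhomogMn; rewrite dhomogX; apply/eqP/mdeg1.
suff -> : row c 1%:M = form_rV j p *m restr_mx j by exact: submxMl.
rewrite mulmx_restr form_rV_K // rmorphM !rmorphXn /= !restrX h1 h2 expr1n mul1r.
by apply/rowP => b; rewrite !mxE coefXn eq_sym.
Qed.

(* Dimension of the image of [Ann_S(G)_j] in [S / (l)]. *)
Definition annw (G : {mpoly k[3]}) j : nat :=
  \rank (kermx (contr_mx G j) *m restr_mx j).

Lemma hilbA_annw0 G : (hilbA G 0 + annw G 0 = 1)%N.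
Proof.
have := mxrank_mul_ker (kermx (contr_mx G 0)) (restr_mx 0).
have := mxrankS (capmxSr (kermx (contr_mx G 0)) (kermx (restr_mx 0))).
rewrite mxrank_ker; have /eqP-> := restr_mx_full 0.
have := rank_ker_hilbA G 0; have : nmon 0 = 1%N by rewrite nmonE.
rewrite /annw; lia.
Qed.

Lemma annw_mono F G j : (forall g, apolar g F = 0 -> apolar g G = 0) ->
  (annw F j <= annw G j)%N.
Proof.
move=> FG; apply/mxrankS/submxMr/rV_subP => v; rewrite !sub_ker_contr_mx.
by move=> /eqP/FG/eqP.
Qed.

(** The annihilator is an ideal, so multiplying by the variables [i1] and [i2] sends its restriction
    in degree [j] into the one in degree [j.+1]. On restrictions these are multiplications by [1]
    and ['X], as [rank_mulX_growth] requires. *)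
Lemma annw_growth G j : (0 < annw G j)%N -> (annw G j < annw G j.+1)%N.
Proof.
rewrite lt0n mxrank_eq0 => W0.
have mulX c (v : 'rV_j.+1) : (v <= kermx (contr_mx G j) *m restr_mx j)%MS ->
    (poly_rV (h c * rVpoly v) <= kermx (contr_mx G j.+1) *m restr_mx j.+1)%MS.
  case/submxP=> D ->; rewrite mulmxA mulmx_restr.
  set u := D *m _; have uK : (u <= kermx (contr_mx G j))%MS by exact: submxMl.
  rewrite poly_rV_K ?size_restr ?rVform_homog // -restrX -rmorphM.
  have hu : 'X_c * rVform u \is j.+1.-homog.
    apply: (dhomogM (d := 1)); last exact: rVform_homog.
    by rewrite dhomogX; apply/eqP/mdeg1.
  rewrite -(form_rV_K hu) -mulmx_restr submxMr // sub_ker_contr_mx form_rV_K // apolarM.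
  by move: uK; rewrite sub_ker_contr_mx => /eqP->; rewrite apolar0.
apply: rank_mulX_growth => // v vW; last by rewrite -h2 mulX.
by rewrite -[rVpoly v]mul1r -h1 mulX.
Qed.

Variable l : {mpoly k[3]}.
Hypotheses (l_lin : l \is 1.-homog) (l_neq0 : l != 0) (restr_l : restr l = 0).

Definition mull_mx j : 'M[k]_(nmon j, nmon j.+1) :=
  \matrix_a form_rV j.+1 (l * 'X_[mon a]).

Lemma mulmx_mull j (v : 'rV[k]_(nmon j)) :
  v *m mull_mx j = form_rV j.+1 (l * rVform v).
Proof.
rewrite mulmx_sum_row /rVform mulr_sumr linear_sum; apply: eq_bigr => a _.
by rewrite rowK -scalerAr linearZ.
Qed.

Lemma mull_homog j p : p \is j.-homog -> l * p \is j.+1.-homog.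
Proof. exact: dhomogM l_lin. Qed.

Lemma mull_mx_free j : row_free (mull_mx j).
Proof.
apply: inj_row_free => v; rewrite mulmx_mull => /eqP.
rewrite form_rV_eq0 ?mull_homog ?rVform_homog // mulf_eq0 (negbTE l_neq0) /=.
by move=> /eqP v0; rewrite -[v]rVformK v0 linear0.
Qed.

(** Multiples of [l] restrict to zero, and the dimensions agree: [nmon j.+1 - j.+2 = nmon j]. *)
Lemma ker_restr_mx j : (kermx (restr_mx j.+1) :=: mull_mx j)%MS.
Proof.
have sub : (mull_mx j <= kermx (restr_mx j.+1))%MS.
  apply/sub_kermxP/row_matrixP => a.
  rewrite row_mul rowK mulmx_restr form_rV_K ?rmorphM /= ?restr_l ?mul0r ?linear0 ?row0 //.
  by rewrite mull_homog // dhomogX; apply/eqP/mdeg_mon.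
apply/eqmx_sym/eqmxP; rewrite -(mxrank_leqif_eq sub) mxrank_ker.
have /eqP-> := restr_mx_full j.+1; have /eqP-> := mull_mx_free j.
by rewrite nmonS addnK.
Qed.

(** Rank-nullity for restriction on the annihilator of [G] in degree [j.+1]: the elements that
    restrict to zero are the [l * v] with [v] in the annihilator of [apolar l G]. *)
Lemma hilbA_annwS G j :
  (hilbA G j.+1 + annw G j.+1 = hilbA (apolar l G) j + j.+2)%N.
Proof.
have := mxrank_mul_ker (kermx (contr_mx G j.+1)) (restr_mx j.+1).
have -> : \rank (kermx (contr_mx G j.+1) :&: kermx (restr_mx j.+1))%MS
    = \rank (kermx (contr_mx (apolar l G) j)).
  rewrite -(mxrankMfree _ (mull_mx_free j)); apply/eqmx_rank/andP; split.
    apply/rV_subP => u; rewrite sub_capmx ker_restr_mx => /andP[uK /submxP[v uE]].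
    rewrite uE submxMr // sub_ker_contr_mx -apolarM mulrC.
    by move: uK; rewrite sub_ker_contr_mx uE mulmx_mull form_rV_K // mull_homog ?rVform_homog.
  rewrite sub_capmx; apply/andP; split; last by rewrite ker_restr_mx submxMl.
  apply/row_subP => a; rewrite row_mul mulmx_mull sub_ker_contr_mx.
  rewrite form_rV_K ?mull_homog ?rVform_homog // mulrC apolarM.
  by rewrite -sub_ker_contr_mx row_sub.
have := rank_ker_hilbA G j.+1; have := rank_ker_hilbA (apolar l G) j.
have := nmonS j; rewrite /annw; lia.
Qed.

End Restriction.

(** * Choice of an affine chart on the line [l = 0] *)

Section RestrictionExists.
Local Open Scope ring_scope.

Lemma restr_exists (k : fieldType) (l : {mpoly k[3]}) :
    l \is 1.-homog -> l != 0 ->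
  exists (h : 'I_3 -> {poly k}) i1 i2, [/\ forall i, (size (h i) <= 2)%N, h i1 = 1, h i2 = 'X
                    & restr h l = 0].
Proof.
move=> hl l0; have [i0 c0] : exists i0 : 'I_3, l@_U_(i0) != 0.
  apply/existsP; apply: contraNT l0 => /existsPn c0.
  rewrite (linear_form_sum hl) big1 // => i _.
  by move/negPn/eqP: (c0 i) => ->; rewrite scale0r.
(* Addition in ['I_3] is cyclic, so [i1] and [i2] are the other two indices. Then [q] is the
   solution of [l = 0] for the variable [i0], once the others are set to [1] and ['X]. *)
pose i1 : 'I_3 := i0 + 1; pose i2 : 'I_3 := i0 + 1 + 1.
pose c i := l@_U_(i).
pose q : {poly k} := - (c i0)^-1 *: ((c i1)%:P + c i2 *: 'X).
pose h i := if i == i0 then q else if i == i1 then 1 else 'X.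
have i10 : i1 != i0 by rewrite /i1; case: (i0) => [[|[|[|]]]].
have i20 : i2 != i0 by rewrite /i2; case: (i0) => [[|[|[|]]]].
have i21 : i2 != i1 by rewrite /i1 /i2; case: (i0) => [[|[|[|]]]].
exists h, i1, i2; split.
- move=> i; rewrite /h; case: ifP => _; last by case: ifP; rewrite ?size_poly1 ?size_polyX.
  apply: (leq_trans (size_scale_leq _ _)); apply: (leq_trans (size_polyD _ _)).
  rewrite geq_max (leq_trans (size_polyC_leq1 _)) //=.
  by rewrite (leq_trans (size_scale_leq _ _)) // size_polyX.
- by rewrite /h (negbTE i10) eqxx.
- by rewrite /h (negbTE i20) (negbTE i21).
rewrite (linear_form_sum hl) restr_sum.
under eq_bigr do rewrite restrX.
rewrite (bigD1 i0) //= (bigD1 i1) //= (big_pred1 i2); last first.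
  move=> i; rewrite /i1 /i2; case: (i0) => m ltm; case: (i) => n ltn.
  by case: m ltm => [|[|[|m]]] // ?; case: n ltn => [|[|[|n]]].
rewrite /h eqxx (negbTE i10) eqxx (negbTE i20) (negbTE i21) /q scalerA mulrN.
rewrite divff // scaleN1r -/(c i1) -/(c i2).
by rewrite -[(c i1)%:P]alg_polyC addNr.
Qed.

End RestrictionExists.

(** * Numerical consequences of growth and symmetry, where [e] stands for [d / 2] *)

Section Combinatorics.

Definition growing (w : nat -> nat) := forall i, 0 < w i -> w i < w i.+1.

Lemma growing_leq w i j : growing w -> 0 < w i -> i <= j -> w i + (j - i) <= w j.
Proof.
move=> gw wi; elim: j => [|j IHj]; first by rewrite leqn0 => /eqP->; rewrite addn0.
rewrite leq_eqVlt => /predU1P[->|]; first by rewrite subnn addn0.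
rewrite ltnS => ij; have le_wj := IHj ij.
by have := gw j (leq_trans wi (leq_trans (leq_addr _ _) le_wj)); lia.
Qed.

Variables (e : nat) (h2 w2 : nat -> nat).
Hypotheses (e_gt0 : 0 < e) (g2 : growing w2).
Hypotheses (sym2 : forall i j, i + j = (2 * e).-2 -> h2 i = h2 j)
  (h2w : forall i, h2 i + w2 i = i.+1).
Let r := h2 e.-1.

(** If [w2 i] were positive, growth up to [e.-1] would force [r <= i]. The lemmas [w1_low] and
    [w0_low] repeat this argument with growth up to [e]. *)
Lemma h2_low i : i < r -> h2 i = i.+1.
Proof.
move=> ir; have := h2w i; have := h2w e.-1; rewrite -/r => hr hi.
case: (posnP (w2 i)) => [|wi]; first lia.
have := growing_leq (j := e.-1) g2 wi; lia.
Qed.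

Lemma h2_high i : r <= i -> i < e -> h2 i = r.
Proof.
move=> ri ie; have := h2w e.-1; rewrite -/r => hr.
(* If [w2 r = 0] then [h2 r = r.+1], and by symmetry so is the value at the reflected degree. But
   growth from [e.-1] to that degree bounds the value there by [r]. *)
have wr : 0 < w2 r.
  have we : 0 < w2 e.-1 by lia.
  have := growing_leq (j := (2 * e).-2 - r) g2 we.
  have := sym2 (i := r) (j := (2 * e).-2 - r); have := h2w r.
  have := h2w ((2 * e).-2 - r); lia.
(* Growth from [r] to [i] bounds [h2 i] above by [r], and growth from [i] to [e.-1] bounds it below
   by [r]. *)
have wi := growing_leq (j := i) g2 wr.
have := growing_leq (i := i) (j := e.-1) g2.
have := h2w i; have := h2w r; lia.
Qed.

(** The recursion for [h1] involves [h2] one degree lower; the constant value [r] is already reached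
    at [r.-1]. *)
Lemma h2_high_pred i : r <= i.+1 -> i < e -> h2 i = r.
Proof.
move=> ri ie; have [ri'|ir] := leqP r i; first exact: h2_high.
by rewrite h2_low //; lia.
Qed.

Variables h1 w1 : nat -> nat.
Hypotheses (g1 : growing w1)
  (sym1 : forall i j, i + j = (2 * e).-1 -> h1 i = h1 j)
  (h1w0 : h1 0 + w1 0 = 1)
  (h1wS : forall i, h1 i.+1 + w1 i.+1 = h2 i + i.+2).
Let s := h1 e.-1.

Section Generic1.
Hypotheses (r_gt0 : 0 < r) (r_lt : r < e) (rs : 2 * r <= s) (se : s <= e + r).

Lemma w1_mid : w1 e = r + e.+1 - s.
Proof.
have := h1wS e.-1; rewrite prednK // -/r.
by have := sym1 (i := e) (j := e.-1); rewrite -/s; lia.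
Qed.

Lemma w1_low i : i + r < s -> w1 i = 0.
Proof.
move=> irs; case: (posnP (w1 i)) => // wi.
have := growing_leq (j := e) g1 wi; have := w1_mid; lia.
Qed.

Lemma h1_low i : i < r -> h1 i = (2 * i).+1.
Proof.
move=> ir; have wi : w1 i = 0 by apply: w1_low; lia.
case: i ir wi => [|i] ir wi; first by have := h1w0; lia.
have := h1wS i; rewrite h2_low; lia.
Qed.

Lemma h1_mid i : r <= i -> i + r < s -> h1 i = (i + r).+1.
Proof.
move=> ri irs; have wi := w1_low irs.
case: i ri irs wi => [|i] ri irs wi; first lia.
have := h1wS i; have [ri'|ir] := leqP r i; first by rewrite h2_high; lia.
rewrite h2_low; lia.
Qed.

Lemma h1_high i : s <= i + r -> i < e -> h1 i = s.
Proof.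
move=> si ie; have we := w1_mid.
(* Otherwise [h1 (s - r) = s.+1], while growth from [e] to the reflected degree
   [(2 * e).-1 - (s - r)] bounds the value there by [s]. *)
have wc : 0 < w1 (s - r).
  have we0 : 0 < w1 e by lia.
  have := growing_leq (j := (2 * e).-1 - (s - r)) g1 we0.
  have := sym1 (i := s - r) (j := (2 * e).-1 - (s - r)).
  have := h1wS (s - r).-1; have := h1wS ((2 * e).-2 - (s - r)).
  rewrite (@h2_high_pred (s - r).-1); [|lia|lia].
  rewrite (sym2 (j := s - r)); last lia.
  rewrite (@h2_high (s - r)); [|lia|lia].
  rewrite prednK; last lia.
  have -> : ((2 * e).-2 - (s - r)).+1 = (2 * e).-1 - (s - r) by lia.
  lia.
have wi := growing_leq (j := i) g1 wc.
have := growing_leq (i := i) (j := e) g1.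
have := h1wS i.-1; rewrite (@h2_high_pred i.-1); [|lia|lia].
rewrite prednK; lia.
Qed.

End Generic1.

Variables h0 w0 : nat -> nat.
Hypotheses (g0 : growing w0)
  (sym0 : forall i j, i + j = 2 * e -> h0 i = h0 j)
  (h0w0 : h0 0 + w0 0 = 1)
  (h0wS : forall i, h0 i.+1 + w0 i.+1 = h1 i + i.+2).
Let t := h0 e.

Section Generic0.
Hypotheses (r_gt0 : 0 < r) (r_lt : r < e) (rs : 2 * r <= s) (se : s <= e + r).
Hypotheses (st : 2 * s <= t + r) (te : t <= e + s + 1).

Lemma w0_mid : w0 e = s + e.+1 - t.
Proof. by have := h0wS e.-1; rewrite prednK // -/s -/t; lia. Qed.

Lemma w0_low i : i + s < t -> w0 i = 0.
Proof.
move=> ist; case: (posnP (w0 i)) => // wi.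
have := growing_leq (j := e) g0 wi; have := w0_mid; lia.
Qed.

Lemma h0_0 : h0 0 = 1.
Proof. by have := h0w0; rewrite w0_low ?addn0 //; lia. Qed.

Lemma h0_low i : 0 < i -> i <= r -> i + s < t -> h0 i = 3 * i.
Proof.
case: i => // i _ ir ist; have := h0wS i; rewrite w0_low //.
rewrite h1_low; lia.
Qed.

Lemma h0_mid i : r < i -> i + r <= s -> i + s < t -> h0 i = (2 * i + r).+1.
Proof.
case: i => // i ri irs ist; have := h0wS i; rewrite w0_low //.
rewrite h1_mid; lia.
Qed.

Lemma h0_mid2 i : s < i + r -> i + s < t -> h0 i = (i + s).+1.
Proof.
case: i => [|i] ri irs; first lia.
have := h0wS i; rewrite w0_low // h1_high; lia.
Qed.

Lemma h1_high_pred i : r < i -> s <= i + r -> i <= e -> h1 i.-1 = s.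
Proof.
move=> ri si ie; have [si'|is'] := leqP s (i.-1 + r).
  by rewrite h1_high //; lia.
by rewrite h1_mid; lia.
Qed.

(* Compares the growth of [w0] between [e] and [2 * e - i] with the value forced
   by the symmetry of [h0]. *)
Lemma w0_reflect i : 0 < i -> i < e -> t <= e + s ->
  i.+1 + s + h1 i.-1 <= w0 i + t + h1 i.
Proof.
move=> i0 ie tes; have we := w0_mid; have we0 : 0 < w0 e by lia.
have := growing_leq (j := 2 * e - i) g0 we0.
have := sym0 (i := i) (j := 2 * e - i).
have := h0wS i.-1; have := h0wS (2 * e - i).-1.
rewrite !prednK; [|lia|lia].
rewrite (sym1 (i := (2 * e - i).-1) (j := i)); lia.
Qed.

(** In this range [h1 i.-1 = s], so the claim amounts to [h0 i <= t]. *)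
Lemma w0_ge i : r < i -> t <= i + s -> i <= e -> i.+1 + s <= w0 i + t.
Proof.
move=> ri tis ie; have we := w0_mid.
(* The first degree in the range. If [b < e], then [h1] equals [s] at both [b.-1] and [b], so the
   two terms cancel in [w0_reflect]; growth then carries the bound from [b] to [i]. *)
pose b := maxn (t - s) r.+1.
have wb : b.+1 + s <= w0 b + t.
  have [be|eb] := ltnP b e; last first.
    have -> : b = e by lia.
    lia.
  have := @w0_reflect b; rewrite h1_high_pred; [|lia|lia|lia].
  rewrite h1_high; lia.
have wb0 : 0 < w0 b by lia.
have := growing_leq (j := i) g0 wb0; lia.
Qed.

Lemma h0_high i : r < i -> t <= i + s -> i <= e -> h0 i = t.
Proof.
move=> ri tis ie; have := w0_ge ri tis ie; have := w0_mid => we wi.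
have := growing_leq (i := i) (j := e) g0.
have := h0wS i.-1; rewrite prednK; last lia.
rewrite h1_high_pred; lia.
Qed.

(** Here [t = 3 * r] forces [s = 2 * r], so [h0 r = 3 * r - w0 r]. Growth up to [w0 e = e.+1 - r]
    leaves only [w0 r <= 1], whence the two possible functions. *)
Lemma h0_r : t = 3 * r -> h0 r = 3 * r \/ h0 r = 3 * r - 1.
Proof.
move=> t3; have we := w0_mid.
have := growing_leq (i := r) (j := e) g0.
have := h0wS r.-1; rewrite prednK // h1_low; lia.
Qed.

End Generic0.

Lemma hilbert_part1 :
  0 < r -> r <= e - 1 -> 2 * r <= s -> s <= e + r -> 2 * s <= t + r ->
  t <= e + s + 1 ->
     (forall i, i < r -> h2 i = i.+1) /\
     (forall i, r <= i -> i <= e - 1 -> h2 i = r) /\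
     (forall i, i < r -> h1 i = (2 * i).+1) /\
     (forall i, r <= i -> i + r + 1 <= s -> h1 i = (i + r).+1) /\
     (forall i, s <= i + r -> i <= e - 1 -> h1 i = s) /\
     (t = 3 * r ->
        ((h0 0 = 1 /\
          (forall i, 1 <= i -> i + 1 <= r -> h0 i = 3 * i) /\
          (forall i, r <= i -> i <= e -> h0 i = 3 * r))
         \/
         (h0 0 = 1 /\
          (forall i, 1 <= i -> i + 1 <= r -> h0 i = 3 * i) /\
          h0 r = 3 * r - 1 /\
          (forall i, r + 1 <= i -> i <= e -> h0 i = 3 * r)))) /\
     (t <> 3 * r ->
        h0 0 = 1 /\
        (forall i, 1 <= i -> i <= r -> h0 i = 3 * i) /\
        (forall i, r + 1 <= i -> i + r + 1 <= s -> h0 i = (2 * i + r).+1) /\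
        (t + r > 2 * s -> s > 2 * r -> h0 (s - r) = (2 * (s - r) + r).+1) /\
        (t + r > 2 * s -> s = 2 * r -> h0 (s - r) = 2 * (s - r) + r) /\
        (forall i, s + 1 <= i + r -> i + s + 1 <= t -> h0 i = (i + s).+1) /\
        (forall i, t <= i + s -> i <= e -> h0 i = t)).
Proof.
move=> r0 re rs se st te; have re' : r < e by lia.
split; first exact: h2_low.
split; first by move=> i ri ie; apply: h2_high; lia.
split; first exact: h1_low.
split; first by move=> i ri irs; apply: h1_mid; lia.
split; first by move=> i ri irs; apply: h1_high; lia.
have h00 : h0 0 = 1 by exact: h0_0.
split=> t3.
  have low i : 1 <= i -> i + 1 <= r -> h0 i = 3 * i by move=> i1 ir; apply: h0_low; lia.
  have high i : r + 1 <= i -> i <= e -> h0 i = 3 * r.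
    by move=> ri ie; rewrite h0_high; lia.
  have [] : h0 r = 3 * r \/ h0 r = 3 * r - 1 by exact: h0_r.
    move=> hr; left; split=> //; split=> // i; rewrite leq_eqVlt.
    by move=> /predU1P[<-//|ri]; apply: high; lia.
  by move=> hr; right.
split=> //; split; first by move=> i i1 ir; apply: h0_low; lia.
split; first by move=> i ri irs; apply: h0_mid; lia.
split; first by move=> ts sr; apply: h0_mid; lia.
(* Now [s - r = r], so this degree lies in the range where [h0 i = 3 * i]. *)
split; first by move=> ts sr; rewrite h0_low; lia.
split; first by move=> i si ist; apply: h0_mid2; lia.
(* The bounds give [r <= i], and [i = r] would force [s = 2 * r] and [t = 3 * r], which is
   excluded. *)
by move=> i ti ie; apply: h0_high; lia.
Qed.

Hypothesis w02 : forall i, w0 i <= w2 i.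

(** The values of [r] and [s] are maximal, so [w2] and [w1] vanish below [e]. The vanishing of [w0]
    follows from that of [w2] through [w02]. *)
Lemma hilbert_part2 : r = e -> s = 2 * e - 1 ->
     (forall i, i < e -> h2 i = i.+1 /\ h1 i = (2 * i).+1) /\
     h0 0 = 1 /\
     (forall i, 1 <= i -> i < e -> h0 i = 3 * i).
Proof.
move=> re sE.
have h2E i : i < e -> h2 i = i.+1 by rewrite -{1}re; apply: h2_low.
have w1e : w1 e.-1 = 0.
  move: sE; rewrite /s; case: (e) e_gt0 h2E => //= -[|n] _ h2E; first by have := h1w0; lia.
  have := h1wS n; rewrite h2E //; lia.
have h1E i : i < e -> h1 i = (2 * i).+1.
  move=> ie; case: (posnP (w1 i)) => [wi|wi]; last first.
    by have := growing_leq (j := e.-1) g1 wi; lia.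
  case: i ie wi => [|i] ie wi; first by have := h1w0; lia.
  have := h1wS i; rewrite h2E; lia.
have w0E i : i < e -> w0 i = 0.
  by move=> ie; have := w02 i; have := h2w i; rewrite h2E //; lia.
split; first by move=> i ie; rewrite h2E ?h1E.
split; first by have := h0w0; rewrite w0E // addn0.
case=> // i _ ie; have := h0wS i; rewrite w0E // h1E; lia.
Qed.

End Combinatorics.

(** * Assembly of the algebraic and numerical parts *)

Theorem theorem4p2 (k : fieldType) (chark : [pchar k]%R =i pred0)
  (F : {mpoly k[3]}) (d : nat)
  (F_neq0 : F != 0%R) (F_homog : F \is d.-homog)
  (d_even : ~~ odd d) (d_ge2 : (2 <= d))
  (l : {mpoly k[3]}) (l_lin : l \is 1.-homog)
  (l2 : apolar (l ^+ 2)%R F != 0%R) (l3 : apolar (l ^+ 3)%R F = 0%R) :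
  let hA := hilbA F in
  let h1 := hilbA (apolar l F) in
  let h2 := hilbA (apolar (l ^+ 2)%R F) in
  let e := d./2 in
  let r := h2 e.-1 in
  let s := h1 e.-1 in
  let t := hA e in
  (* part (1) *)
  ((4 <= d) -> (1 <= r) -> (r <= e - 1) ->
   (2 * r <= s) -> (s <= e + r) ->
   (2 * s <= t + r) -> (t <= e + s + 1) ->
     (* A^(2) *)
     (forall i, (i < r) -> h2 i = i.+1) /\
     (forall i, (r <= i) -> (i <= e - 1) -> h2 i = r) /\
     (* A^(1) *)
     (forall i, (i < r) -> h1 i = (2 * i).+1) /\
     (forall i, (r <= i) -> (i + r + 1 <= s) -> h1 i = (i + r).+1) /\
     (forall i, (s <= i + r) -> (i <= e - 1) -> h1 i = s) /\
     (* A *)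
     (t = 3 * r ->
        ((hA 0 = 1 /\
          (forall i, (1 <= i) -> (i + 1 <= r) -> hA i = 3 * i) /\
          (forall i, (r <= i) -> (i <= e) -> hA i = 3 * r))
         \/
         (hA 0 = 1 /\
          (forall i, (1 <= i) -> (i + 1 <= r) -> hA i = 3 * i) /\
          hA r = (3 * r - 1) /\
          (forall i, (r + 1 <= i) -> (i <= e) -> hA i = 3 * r)))) /\
     (t <> 3 * r ->
        hA 0 = 1 /\
        (forall i, (1 <= i) -> (i <= r) -> hA i = 3 * i) /\
        (forall i, (r + 1 <= i) -> (i + r + 1 <= s) ->
           hA i = (2 * i + r).+1) /\
        ((t + r > 2 * s) -> (s > 2 * r) -> hA (s - r) = (2 * (s - r) + r).+1) /\
        ((t + r > 2 * s) -> s = (2 * r) -> hA (s - r) = (2 * (s - r) + r)) /\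
        (forall i, (s + 1 <= i + r) -> (i + s + 1 <= t) -> hA i = (i + s).+1) /\
        (forall i, (t <= i + s) -> (i <= e) -> hA i = t)))
  /\
  (* part (2) *)
  (r = e -> s = (d - 1) -> (3 * e <= t + 2) -> (t <= 3 * e) ->
     (forall i, (i < e) -> h2 i = i.+1 /\ h1 i = (2 * i).+1) /\
     hA 0 = 1 /\
     (forall i, (1 <= i) -> (i < e) -> hA i = 3 * i) /\
     hA e = t).
Proof.
move=> hA h1 h2 e r s t.
have l_neq0 : l != 0%R.
  apply: contraNneq l2 => ->.
  by rewrite expr0n /apolar msupp0 big_nil.
have [h [i1 [i2 [size_h hi1 hi2 restr_l]]]] := restr_exists l_lin l_neq0.
have l2E : apolar (l ^+ 2)%R F = apolar l (apolar l F) by rewrite expr2 apolarM.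
have l3E : apolar l (apolar (l ^+ 2)%R F) = 0%R by rewrite -apolarM -exprS.
have dE : d = 2 * e by rewrite mul2n even_halfK.
have e_gt0 : 0 < e by lia.
have F1_homog : apolar l F \is ((2 * e).-1).-homog.
  by rewrite -dE -subn1; apply: apolar_homog.
have F2_homog : apolar (l ^+ 2)%R F \is ((2 * e).-2).-homog.
  by rewrite -dE -subn2; apply: apolar_homog => //; apply: (dhomogMn 2 l_lin).
have hw0 G := hilbA_annw0 hi1 hi2 G.
have hwS G := hilbA_annwS hi1 hi2 l_lin l_neq0 restr_l G.
have gr G : growing (annw h G) by move=> i; apply: (annw_growth size_h hi1 hi2).
have sym0 i j : i + j = 2 * e -> hA i = hA j.
  by rewrite -dE; apply: hilbA_sym.
have sym1 i j : i + j = (2 * e).-1 -> h1 i = h1 j by apply: hilbA_sym.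
have sym2 i j : i + j = (2 * e).-2 -> h2 i = h2 j by apply: hilbA_sym.
(* As [l ^+ 3] kills [F], the term coming from [apolar l (apolar (l ^+ 2) F)] is zero, so [h2] is
   the Hilbert function of the cokernel itself. *)
have h2w i : h2 i + annw h (apolar (l ^+ 2)%R F) i = i.+1.
  by case: i => [|i]; [exact: hw0 | rewrite /h2 hwS l3E hilbA0].
have h1wS i : h1 i.+1 + annw h (apolar l F) i.+1 = h2 i + i.+2.
  by rewrite /h1 hwS -l2E.
have h0wS i : hA i.+1 + annw h F i.+1 = h1 i + i.+2 by rewrite /hA hwS.
split=> [_|re se _ _].
  exact: (hilbert_part1 e_gt0 (gr _) sym2 h2w (gr (apolar l F)) sym1 (hw0 _)
            h1wS (gr F) sym0 (hw0 _) h0wS).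
have w02 i : annw h F i <= annw h (apolar (l ^+ 2)%R F) i.
  by apply: annw_mono => g gF; rewrite -apolarM mulrC apolarM gF apolar0.
have s2 : s = 2 * e - 1 by rewrite se dE.
have [h12 [h00 h0i]] := hilbert_part2 e_gt0 (gr _) h2w
  (gr (apolar l F)) (hw0 _) h1wS (hw0 F) h0wS w02 re s2.
by [].
Qed.
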